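(* Let $J$ be either $(0,1]$ or $[1,\infty)$, and let $f$ be a positive function on $J$ of class $C^1$ with $f(1)=1$. Put $H_f(x):=x f'(x)$ for $x\in J$. (a) A sufficient condition for $f$ to be an $l$-Weierstrass function on $J$ is that $H_f$ is non-decreasing on $J$. If $H_f$ is strictly increasing, then the inequality $f(xy)\geq f(x)+f(y)-1$ (for $x,y\in J$) is strict. (b) A sufficient condition for $f$ to be an $r$-Weierstrass function on $J$ is that $H_f$ is non-increasing on $J$. If $H_f$ is strictly decreasing, then the inequality $f(xy)\leq f(x)+f(y)-1$ (for $x,y\in J$) is strict.
   Context: Let $J$ be either $(0,1]$ or $[1,\infty)$. A positive function $f$ on $J$ with $f(1)=1$ is called $l$-Weierstrass (left-Weierstrass) on $J$ if $f(xy)\geq f(x)+f(y)-1$ for all $x,y\in J$, and $r$-Weierstrass (right-Weierstrass) on $J$ if it fulfils the reversed inequality $f(xy)\leq f(x)+f(y)-1$ for all $x,y\in J$.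
   Formalization: Strictness of the inequalities in (a) and (b) is stated only for x, y in J with x ≠ 1 and y ≠ 1, because f(1) = 1 makes both sides equal whenever x = 1 or y = 1. *)

(* Defs.v *)
From HB Require Import structures.
From mathcomp Require Import all_boot all_order all_algebra.
From mathcomp Require Import all_classical all_reals all_analysis.

Set Implicit Arguments.
Unset Strict Implicit.
Unset Printing Implicit Defensive.

Import Order.TTheory GRing.Theory Num.Theory.
Import numFieldNormedType.Exports.

Local Open Scope classical_set_scope.
Local Open Scope ring_scope.

(* Difference quotients are restricted to J, so at the endpoint 1 of ]0, 1] or
   of [1, +oo[ these are the one-sided derivatives, and the values of f outside
   J play no role. *)
Definition derivable_on (R : realType) (J : set R) (f : R -> R) (x : R) : Prop :=
  cvg ((f y - f x) / (y - x) @[y --> within J x^']).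

Definition derive_on (R : realType) (J : set R) (f : R -> R) (x : R) : R :=
  lim ((f y - f x) / (y - x) @[y --> within J x^']).

Definition C1_on (R : realType) (J : set R) (f : R -> R) : Prop :=
  (forall x, J x -> derivable_on J f x) /\
  {within J, continuous (derive_on J f)}.

Definition H (R : realType) (J : set R) (f : R -> R) (x : R) : R :=
  x * derive_on J f x.

Definition l_weierstrass (R : realType) (J : set R) (f : R -> R) : Prop :=
  [/\ forall x, J x -> 0 < f x,
      f 1 = 1 &
      forall x y, J x -> J y -> f (x * y) >= f x + f y - 1].

Definition r_weierstrass (R : realType) (J : set R) (f : R -> R) : Prop :=
  [/\ forall x, J x -> 0 < f x,
      f 1 = 1 &
      forall x y, J x -> J y -> f (x * y) <= f x + f y - 1].

(* If x = 1 or y = 1, then f 1 = 1 makes both sides of the Weierstrass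
   inequality equal, so strictness is only meaningful away from 1. *)
Definition l_weierstrass_strict (R : realType) (J : set R) (f : R -> R) : Prop :=
  forall x y, J x -> J y -> x != 1 -> y != 1 -> f (x * y) > f x + f y - 1.

Definition r_weierstrass_strict (R : realType) (J : set R) (f : R -> R) : Prop :=
  forall x y, J x -> J y -> x != 1 -> y != 1 -> f (x * y) < f x + f y - 1.

(* Main.v *)
Require Import Defs.
From HB Require Import structures.
From mathcomp Require Import all_boot all_order all_algebra.
From mathcomp Require Import all_classical all_reals all_analysis.
From mathcomp Require Import ring lra.

Import Order.TTheory GRing.Theory Num.Theory.
Import numFieldNormedType.Exports.

Local Open Scope classical_set_scope.
Local Open Scope ring_scope.

(** Writing H for the function x * f'(x), fix y in J and differentiate the map
    t |-> f (t y) - f t: its derivative is y f'(t y) - f'(t), which equals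
    (H (t y) - H t) / t.  Since f 1 = 1, the increment of this map from 1 to x
    is exactly the defect f (x y) - (f x + f y - 1) of the Weierstrass
    inequality.  By the mean value theorem the defect is
    (H (c y) - H c) * (x - 1) / c for some c strictly between 1 and x.

    On [1, +oo[ one has c < c y and x > 1; on ]0, 1] both comparisons are
    reversed.  Hence in both cases the defect is k * (H v - H u) for some
    k > 0 and some u < v in J ([weierstrass_defect]), so that the defect has
    the sign dictated by the monotonicity of H, whichever direction it goes and
    whether or not it is strict.  All four claims are read off from this one
    identity; the cases x = 1 and y = 1 are equalities.

    The mean value theorem needs two-sided derivatives in the interior of J,
    where they agree with the derivatives relative to J
    ([is_derive_derive_on]), and continuity on J up to the endpoint 1
    ([derivable_on_continuous]). *)

(** This equates the two limits as filters, so that existence and value of the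
    derivative relative to J transfer to the ordinary derivative at once. *)
Lemma difference_quotient_interior (R : realType) (J : set R) (f : R -> R)
    (x : R) :
  J° x ->
  ((f y - f x) / (y - x) @[y --> within J x^']) =
  (fun h : R => h^-1 *: ((f \o shift x) (h *: (1 : R)) - f x)) @ 0^'.
Proof.
move=> Jx; apply/seteqP; split=> W /=.
- move=> W_near.
  (* change of variable y = x + h *)
  have : \forall y \near x, y != x -> J y -> W ((f y - f x) / (y - x)).
    exact: W_near.
  rewrite (near_shift 0) subr0 => W_shift.
  have : \forall y \near x, J y by exact: Jx.
  rewrite (near_shift 0) subr0 => J_shift.
  change (\forall h \near (0 : R), h != 0 ->
    W (h^-1 *: ((f \o shift x) (h *: (1 : R)) - f x))).
  near=> h => h0.
  have : (J \o shift x) h by near: h.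
  have : ((fun y => y != x -> J y -> W ((f y - f x) / (y - x))) \o shift x) h.
    by near: h.
  rewrite /= addrK -[h *: 1]/(h * 1) mulr1 => Wh Jh.
  rewrite -[_ *: _]/(_ * _) mulrC; apply: Wh => //.
  by rewrite -subr_eq0 addrK.
- move=> W_near.
  have : \forall h \near (0 : R), h != 0 ->
      W (h^-1 *: ((f \o shift x) (h *: (1 : R)) - f x)) by exact: W_near.
  rewrite (near_shift x) sub0r => W_shift.
  change (\forall y \near x, y != x -> J y -> W ((f y - f x) / (y - x))).
  near=> y => yx _.
  have : ((fun h => h != 0 -> W (h^-1 *: ((f \o shift x) (h *: (1 : R)) - f x)))
            \o shift (- x)) y by near: y.
  rewrite /= -[(y - x) *: 1]/((y - x) * 1) mulr1 subrK subr_eq0.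
  by rewrite -[_ *: _]/(_ * _) mulrC; exact.
Unshelve. all: by end_near. Qed.

Lemma is_derive_derive_on (R : realType) (J : set R) (f : R -> R) (x : R) :
  J° x -> derivable_on J f x -> is_derive x 1 f (derive_on J f x).
Proof.
move=> Jx; rewrite /derivable_on /derive_on.
by rewrite difference_quotient_interior// => ?; split.
Qed.

(** The usual argument f y = f x + q y * (y - x), with q the difference quotient
    relative to J; it gives the one-sided continuity at an endpoint in J. *)
Lemma derivable_on_continuous (R : realType) (J : set R) (f : R -> R) :
  (forall x, J x -> derivable_on J f x) -> {within J, continuous f}.
Proof.
move=> df; apply/subspace_continuousP => x Jx.
have cvg_punctured : f y @[y --> within J x^'] --> f x.
  have y_x : y - x @[y --> within J x^'] --> x - x.
    apply: cvg_within_filter; apply: cvg_within_filter.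
    by apply: cvgB; [exact: cvg_id|exact: cvg_cst].
  have : f x + (f y - f x) / (y - x) * (y - x) @[y --> within J x^']
      --> f x + derive_on J f x * (x - x).
    by apply: cvgD; [exact: cvg_cst|apply: cvgM => //; exact: df].
  rewrite subrr mulr0 addr0 => lim_affine.
  refine (cvg_trans _ lim_affine); apply: (@near_eq_cvg _ _ (within J x^')).
  change (\forall y \near x, y != x -> J y ->
    f x + (f y - f x) / (y - x) * (y - x) = f y).
  near=> y => yx _.
  by rewrite divfK ?subr_eq0// addrC subrK.
move=> W fxW.
have W_near : \forall y \near x, y != x -> J y -> W (f y).
  exact: cvg_punctured W fxW.
change (\forall y \near x, J y -> W (f y)).
near=> y => Jy; have [->|yx] := eqVneq y x; first exact: nbhs_singleton.
by move: yx Jy; near: y.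
Unshelve. all: by end_near. Qed.

(** The two domains share what the mean value argument requires: each is an
    interval stable under product, whose only point outside its interior is
    the endpoint 1.  Only the orientation of [weierstrass_defect] tells them
    apart. *)
Definition unit_ray {R : realType} (J : set R) : Prop :=
  J = `]0, 1]%classic \/ J = `[1, +oo[%classic.

Section UnitRay.
Context {R : realType} {J : set R}.
Implicit Types x y c : R.

Lemma unit_ray_1 : unit_ray J -> J 1.
Proof. by case=> ->; rewrite /= in_itv/= ?lexx ?ltr01. Qed.

Lemma unit_ray_gt0 x : unit_ray J -> J x -> 0 < x.
Proof. by case=> ->; rewrite /= in_itv/= ?andbT => h; lra. Qed.

Lemma unit_ray_itv : unit_ray J -> is_interval J.
Proof. by case=> ->; exact: interval_is_interval. Qed.

Lemma unit_rayM x y : unit_ray J -> J x -> J y -> J (x * y).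
Proof. by case=> ->; rewrite /= !in_itv/= ?andbT => h k; nra. Qed.

Lemma unit_rayM_neq1 x y : unit_ray J -> J x -> J y -> y != 1 -> x * y != 1.
Proof.
case=> ->; rewrite /= !in_itv/= ?andbT => hx hy y1.
  have {}y1 : y < 1 by rewrite lt_neqAle y1; lra.
  by rewrite lt_eqF//; nra.
have {}y1 : 1 < y by rewrite lt_neqAle eq_sym y1.
by rewrite gt_eqF//; nra.
Qed.

Lemma unit_ray_interior x : unit_ray J -> J x -> x != 1 -> J° x.
Proof.
case=> ->; rewrite /= in_itv/= ?andbT => hx x1.
  have x_lt1 : x < 1 by rewrite lt_neqAle x1; lra.
  have xoo : x \in `]0, 1[ by rewrite in_itv/= x_lt1; lra.
  apply: filterS (near_in_itvoo xoo) => z /=; rewrite !in_itv/= => hz; lra.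
have xoy : x \in `]1, +oo[ by rewrite in_itv/= andbT lt_neqAle eq_sym x1.
by apply: filterS (near_in_itvoy xoy) => z /=; rewrite !in_itv/= !andbT => /ltW.
Qed.

Lemma unit_ray_between_neq1 a b c :
  unit_ray J -> J a -> J b -> a < c -> c < b -> c != 1.
Proof.
case=> ->; rewrite /= !in_itv/= ?andbT => ha hb ac cb.
  by rewrite lt_eqF//; lra.
by rewrite gt_eqF//; lra.
Qed.

End UnitRay.

(** The mean value theorem for t |-> f (t y) - f t.  The hypothesis y != 1 keeps
    t y away from 1, even for t = 1, so that t |-> f (t y) is differentiable on
    the whole of J; for t |-> f t only continuity is available at 1, but 1 is
    never strictly between two points of J. *)
Lemma MVT_dilation_diff (R : realType) (J : set R) (f : R -> R) (y a b : R) :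
  unit_ray J -> (forall x, J x -> derivable_on J f x) -> J y -> y != 1 ->
  J a -> J b -> a < b ->
  exists2 c, a < c < b &
    (f (b * y) - f b) - (f (a * y) - f a) =
    (H J f (c * y) - H J f c) / c * (b - a).
Proof.
move=> rJ df Jy y1 Ja Jb ab.
have abJ : `[a, b] `<=` J.
  by move=> z /=; rewrite in_itv/=; exact: unit_ray_itv.
have df_int z : J z -> z != 1 -> is_derive z 1 f (derive_on J f z).
  move=> Jz z1.
  by apply: is_derive_derive_on; [exact: unit_ray_interior|exact: df].
have dfy z : J z -> is_derive z 1 (fun t => f (t * y)) (derive_on J f (z * y) * y).
  move=> Jz; apply: (@is_derive1_comp _ f (fun t => t * y)).
    by apply: df_int; [exact: unit_rayM|exact: (unit_rayM_neq1 _ _ rJ)].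
  have := is_deriveM (is_derive_id z 1) (is_derive_cst y z 1).
  by rewrite scaler0 add0r -[y *: 1]/(y * 1) mulr1.
have [||c] := @MVT _ (fun t => f (t * y) - f t)
    (fun t => derive_on J f (t * y) * y - derive_on J f t) a b ab.
- move=> z; rewrite in_itv/= => /andP[az zb].
  have Jz : J z by apply: abJ; rewrite /= in_itv/= !ltW.
  apply: is_deriveB; first exact: dfy.
  by apply: df_int => //; exact: (unit_ray_between_neq1 _ _ _ rJ Ja Jb az zb).
- apply: (continuous_subspaceW abJ) => z.
  apply: continuousB; last exact: derivable_on_continuous.
  move: z; apply: continuous_in_subspaceT => z; rewrite inE => Jz.
  have [dz _] := dfy z Jz.
  by apply: differentiable_continuous; apply/derivable1_diffP.
- rewrite in_itv/= => acb ->; exists c => //.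
  have c0 : 0 < c.
    apply: unit_ray_gt0 rJ _; apply: abJ.
    by case/andP: acb => ac cb; rewrite /= in_itv/= !ltW.
  by rewrite /H; congr (_ * _); field; rewrite gt_eqF.
Qed.

(** The positive factor k is |x - 1| / c, and u < v are the points c and c y in
    increasing order: on ]0, 1] multiplication by y moves c down, and the
    resulting sign is compensated by that of x - 1. *)
Lemma weierstrass_defect (R : realType) (J : set R) (f : R -> R) (x y : R) :
  unit_ray J -> (forall x, J x -> derivable_on J f x) -> f 1 = 1 ->
  J x -> J y -> x != 1 -> y != 1 ->
  exists u v k, [/\ J u, J v, u < v, 0 < k &
    f (x * y) - (f x + f y - 1) = k * (H J f v - H J f u)].
Proof.
move=> rJ df f1 Jx Jy x1 y1.
have J1 := unit_ray_1 rJ.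
have MVTy := MVT_dilation_diff _ _ _ _ _ _ rJ df Jy y1.
case: (rJ) => JE.
  have [x_le1 y_le1] : x <= 1 /\ y <= 1.
    by move: Jx Jy; rewrite JE /= !in_itv/= => /andP[_ ->] /andP[_ ->].
  have x_lt1 : x < 1 by rewrite lt_neqAle x1.
  have y_lt1 : y < 1 by rewrite lt_neqAle y1.
  have [c /andP[xc c1]] := MVTy _ _ Jx J1 x_lt1; rewrite mul1r f1 => E.
  have Jc : J c by apply: (unit_ray_itv rJ x 1) => //; rewrite !ltW.
  have c0 := unit_ray_gt0 _ rJ Jc.
  exists (c * y), c, ((1 - x) / c); split=> //.
  - exact: unit_rayM.
  - by rewrite gtr_pMr.
  - by rewrite divr_gt0 ?subr_gt0.
  - have -> : f (x * y) - (f x + f y - 1) = - (f y - 1 - (f (x * y) - f x)).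
      by ring.
    by rewrite E; field; rewrite gt_eqF.
have [x_ge1 y_ge1] : 1 <= x /\ 1 <= y.
  by move: Jx Jy; rewrite JE /= !in_itv/= !andbT.
have x_gt1 : 1 < x by rewrite lt_neqAle eq_sym x1.
have y_gt1 : 1 < y by rewrite lt_neqAle eq_sym y1.
have [c /andP[c1 cx]] := MVTy _ _ J1 Jx x_gt1; rewrite mul1r f1 => E.
have Jc : J c by apply: (unit_ray_itv rJ 1 x) => //; rewrite !ltW.
have c0 := unit_ray_gt0 _ rJ Jc.
exists c, (c * y), ((x - 1) / c); split=> //.
- exact: unit_rayM.
- by rewrite ltr_pMr.
- by rewrite divr_gt0 ?subr_gt0.
- have -> : f (x * y) - (f x + f y - 1) = f (x * y) - f x - (f y - 1) by ring.
  by rewrite E; field; rewrite gt_eqF.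
Qed.

Theorem theorem2 (R : realType) (J : set R) (f : R -> R)
    (hJ : J = `]0, 1]%classic \/ J = `[1, +oo[%classic)
    (f_gt0 : forall x, J x -> 0 < f x)
    (f_C1 : C1_on J f)
    (f1 : f 1 = 1) :
  (((forall x y, J x -> J y -> x <= y -> H J f x <= H J f y) ->
      l_weierstrass J f) /\
   ((forall x y, J x -> J y -> x < y -> H J f x < H J f y) ->
      l_weierstrass_strict J f)) /\
  (((forall x y, J x -> J y -> x <= y -> H J f y <= H J f x) ->
      r_weierstrass J f) /\
   ((forall x y, J x -> J y -> x < y -> H J f y < H J f x) ->
      r_weierstrass_strict J f)).
Proof.
have [df _] := f_C1.
have defect x y := weierstrass_defect _ _ _ x y hJ df f1.
split; split=> mono.
- split=> // x y Jx Jy.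
  have [->|x1] := eqVneq x 1; first by rewrite mul1r f1; lra.
  have [->|y1] := eqVneq y 1; first by rewrite mulr1 f1; lra.
  have [u [v [k [Ju Jv uv k0 E]]]] := defect x y Jx Jy x1 y1.
  by rewrite -subr_ge0 E pmulr_rge0// subr_ge0; apply: mono => //; exact: ltW.
- move=> x y Jx Jy x1 y1.
  have [u [v [k [Ju Jv uv k0 E]]]] := defect x y Jx Jy x1 y1.
  by rewrite -subr_gt0 E pmulr_rgt0// subr_gt0; exact: mono.
- split=> // x y Jx Jy.
  have [->|x1] := eqVneq x 1; first by rewrite mul1r f1; lra.
  have [->|y1] := eqVneq y 1; first by rewrite mulr1 f1; lra.
  have [u [v [k [Ju Jv uv k0 E]]]] := defect x y Jx Jy x1 y1.
  by rewrite -subr_le0 E pmulr_rle0// subr_le0; apply: mono => //; exact: ltW.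
- move=> x y Jx Jy x1 y1.
  have [u [v [k [Ju Jv uv k0 E]]]] := defect x y Jx Jy x1 y1.
  by rewrite -subr_lt0 E pmulr_rlt0// subr_lt0; exact: mono.
Qed.
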